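(* For every integer $n \geq 1$, the forgetful function \[\varphi_n: [S^n \times S^n, S^n \times S^n]^{\Delta} \longrightarrow [S^n \times S^n, S^n \times S^n]^{\ast}\] is injective; equivalently, the fundamental action of $\pi_{n+1}(S^n \times S^n) = \pi_{n+1}(S^n)\oplus\pi_{n+1}(S^n)$ on $[S^n \times S^n, S^n \times S^n]^{\Delta}$ is trivial.
   Context: Let $\Delta: D = S^n \to S^n \times S^n$ be the diagonal, viewed as a cofibration. For a cofibration $i: D \rightarrowtail X$ and a map $u: D \to U$, $[X,U]^u$ denotes the set of homotopy classes, relative to $D$, of maps $f: X \to U$ with $fi = u$; $[X,U]^{\ast}$ denotes pointed homotopy classes. Here $[S^n\times S^n, S^n\times S^n]^{\Delta}$ means $[X,U]^u$ with $X=U=S^n\times S^n$ and $u=\Delta$, and $\varphi_n$ sends the class of a map relative $D$ to the class of the same map relative the base point $\ast \in D$. The fundamental action: for a cofibration $D \rightarrowtail X$ and $u: D\to U$, let $\Sigma_{\ast} D$ be the pushout of $S^1 \times \ast \to \ast$ and $S^1 \times \ast \rightarrowtail S^1 \times D$; the group $[\Sigma_{\ast} D, U]^u$ (maps under $D$, i.e. pointed self-homotopies of $u$) acts on $[X,U]^u$ by extending such a homotopy from $D$ to a homotopy starting at $f$ via the homotopy extension property and taking the end map. For $D = S^n$ one has $[\Sigma_\ast D,U]^u \cong \pi_{n+1}(U)$. Two classes have the same image under the forgetful map iff they lie in the same orbit of this action. *)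

(* Defs.v *)
From HB Require Import structures.
From mathcomp Require Import all_boot all_order all_algebra.
From mathcomp Require Import all_classical all_reals all_analysis.
From mathcomp Require Import Rstruct Rstruct_topology.
From Stdlib Require Import Reals.

Unset Printing Implicit Defensive.

Import Order.TTheory GRing.Theory Num.Theory.
Local Open Scope classical_set_scope.
Local Open Scope ring_scope.

Definition E (n : nat) := 'rV[R]_(n.+1).

Definition sphere (n : nat) : set (E n) :=
  [set x | \sum_(i < n.+1) (x ord0 i) ^+ 2 = 1].

Definition SnxSn (n : nat) : set (E n * E n) :=
  [set p : E n * E n | sphere n p.1 /\ sphere n p.2].

Definition diag_set (n : nat) : set (E n * E n) :=
  [set p : E n * E n | sphere n p.1 /\ p.2 = p.1].

Definition e0 (n : nat) : E n := \row_(j < n.+1) (if j == ord0 then 1 else 0).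
Definition basept (n : nat) : E n * E n := (e0 n, e0 n).

(* A continuous self-map of X = S^n x S^n (given by a function on the
   ambient space, only its restriction to X matters). *)
Definition cont_self_map (n : nat) (f : E n * E n -> E n * E n) : Prop :=
  {within SnxSn n, continuous f} /\ (forall p, SnxSn n p -> SnxSn n (f p)).

Definition homotopic_rel (n : nat) (A : set (E n * E n))
    (f g : E n * E n -> E n * E n) : Prop :=
  exists H : R * (E n * E n) -> E n * E n,
    [/\ {within `[0%R, 1%R]%classic `*` SnxSn n, continuous H},
        (forall t p, `[0%R, 1%R]%classic t -> SnxSn n p -> SnxSn n (H (t, p))),
        (forall p, SnxSn n p -> H (0%R, p) = f p),
        (forall p, SnxSn n p -> H (1%R, p) = g p) &
        (forall t p, `[0%R, 1%R]%classic t -> A p -> H (t, p) = f p)].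

(* Elements of [S^n x S^n, S^n x S^n]^Delta: continuous self-maps of X
   restricting to the diagonal inclusion u = Delta on D = S^n. *)
Definition under_diag (n : nat) (f : E n * E n -> E n * E n) : Prop :=
  cont_self_map n f /\ (forall p, diag_set n p -> f p = p).

(* Main.v *)
(** Let [H] be a homotopy from [f] to [g] and put [h_t(x) = H_t(x, x)], a loop
based at the diagonal inclusion.  The maps [k_t(x, y) = (h_t(x).1, h_t(y).2)]
extend [h_t] from the diagonal to the whole product, with [k_0] and [k_1] the
identity, so [k_t \o f] is a self-homotopy of [f] which agrees with [H_t] on the
diagonal.  Following it backwards and then [H] gives a homotopy from [f] to [g]
which, on the diagonal, is a path followed by its inverse.

To contract that path away, a point [p] only travels back from time [1] to time
[1 - u(p)], jumps from [k_(1-u)(f p)] to [H_(1-u)(p)] along a great circle, and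
travels forth to time [1]; here [u] vanishes on the diagonal and is [1] away
from it.  By compactness the two ends of the jump are close to each other as
long as [u < 1], and they coincide when [u = 1]. *)

Require Import Defs.
From mathcomp Require Import all_boot all_order all_algebra.
From mathcomp Require Import all_classical all_reals all_analysis.
From mathcomp Require Import Rstruct Rstruct_topology.
From mathcomp Require Import ring lra.

Set Implicit Arguments.
Unset Strict Implicit.

Import Order.TTheory GRing.Theory Num.Theory numFieldNormedType.Exports.
Local Open Scope classical_set_scope.
Local Open Scope ring_scope.

(** * Continuity on a subset, and positive lower bounds on compact sets *)

Lemma within_continuous_comp_within (T U V : topologicalType) (A : set T)
    (B : set U) (f : T -> U) (g : U -> V) :
  {within A, continuous f} -> (forall x, A x -> B (f x)) ->
  {within B, continuous g} -> {within A, continuous (fun x => g (f x))}.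
Proof.
move=> /subspace_continuousP cf fAB /subspace_continuousP cg.
apply/subspace_continuousP => x Ax.
(* The intermediate filter is the trace on [B] of the neighbourhoods of [f x], since [g] is
   controlled only on [B]. *)
apply: (cvg_comp f g (G := within B (nbhs (f x)))); last exact: cg (fAB _ Ax).
move=> P wP; have : nbhs x [set y | A y -> B (f y) -> P (f y)] := cf _ Ax _ wP.
by apply: filterS => y h Ay; exact: h (fAB _ Ay).
Qed.

Section WithinContinuous.
Variables (T : topologicalType) (A : set T).

Lemma within_continuous_pair (U V : topologicalType) (f : T -> U) (g : T -> V) :
  {within A, continuous f} -> {within A, continuous g} ->
  {within A, continuous (fun x => (f x, g x))}.
Proof. move=> cf cg x; exact (cvg_pair (cf x) (cg x)). Qed.

Lemma within_continuous_post (U V : topologicalType) (f : T -> U) (g : U -> V) :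
  continuous g -> {within A, continuous f} ->
  {within A, continuous (fun x => g (f x))}.
Proof. move=> cg cf x; exact (continuous_comp (cf x) (cg (f x))). Qed.

Lemma within_continuous_fst (U V : topologicalType) (f : T -> U * V) :
  {within A, continuous f} -> {within A, continuous (fun x => (f x).1)}.
Proof. by move=> cf; apply: within_continuous_post cf => x; exact: cvg_fst. Qed.

Lemma within_continuous_snd (U V : topologicalType) (f : T -> U * V) :
  {within A, continuous f} -> {within A, continuous (fun x => (f x).2)}.
Proof. by move=> cf; apply: within_continuous_post cf => x; exact: cvg_snd. Qed.

Lemma within_continuous_id : {within A, continuous (fun x => x)}.
Proof. by apply: continuous_subspaceT => x; exact: cvg_id. Qed.

Lemma within_continuous_cst (U : topologicalType) (u : U) :
  {within A, continuous (fun=> u)}.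
Proof. exact: (continuous_subspaceT (@cst_continuous T U u)). Qed.

Variable (R : realType).

Lemma within_continuous_add (V : normedModType R) (f g : T -> V) :
  {within A, continuous f} -> {within A, continuous g} ->
  {within A, continuous (fun x => f x + g x)}.
Proof. move=> cf cg x; exact (cvgD (cf x) (cg x)). Qed.

Lemma within_continuous_sub (V : normedModType R) (f g : T -> V) :
  {within A, continuous f} -> {within A, continuous g} ->
  {within A, continuous (fun x => f x - g x)}.
Proof. move=> cf cg x; exact (cvgB (cf x) (cg x)). Qed.

Lemma within_continuous_scale (V : normedModType R) (k : T -> R) (f : T -> V) :
  {within A, continuous k} -> {within A, continuous f} ->
  {within A, continuous (fun x => k x *: f x)}.
Proof. move=> ck cf x; exact (cvgZ (ck x) (cf x)). Qed.

Lemma within_continuous_mul (f g : T -> R) :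
  {within A, continuous f} -> {within A, continuous g} ->
  {within A, continuous (fun x => f x * g x)}.
Proof. move=> cf cg x; exact (cvgM (cf x) (cg x)). Qed.

Lemma within_continuous_min (f g : T -> R) :
  {within A, continuous f} -> {within A, continuous g} ->
  {within A, continuous (fun x => Num.min (f x) (g x))}.
Proof. move=> cf cg x; exact (continuous_min (cf x) (cg x)). Qed.

Lemma within_continuous_max (f g : T -> R) :
  {within A, continuous f} -> {within A, continuous g} ->
  {within A, continuous (fun x => Num.max (f x) (g x))}.
Proof. move=> cf cg x; exact (continuous_max (cf x) (cg x)). Qed.

Lemma within_continuous_inv (f : T -> R) : (forall x, A x -> f x != 0) ->
  {within A, continuous f} -> {within A, continuous (fun x => (f x)^-1)}.
Proof.
move=> f0 /subspace_continuousP cf; apply/subspace_continuousP => x Ax.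
exact (cvgV (f0 x Ax) (cf x Ax)).
Qed.

End WithinContinuous.

Lemma compact_pos_lower_bound (R : realType) (T : topologicalType) (A : set T)
    (f : T -> R) : compact A -> {within A, continuous f} ->
  (forall x, A x -> 0 < f x) ->
  exists2 m, 0 < m & forall x, A x -> m <= f x.
Proof.
move=> cA cf f_gt0; have [A0|A0] := pselect (A !=set0); last first.
  by exists 1 => // x Ax; exfalso; apply: A0; exists x.
have [c] := compact_EVT_min A0 cA cf.
rewrite inE => Ac minc; exists (f c); first exact: f_gt0.
by move=> x Ax; apply: minc; rewrite inE.
Qed.

(** * Geometry of the Euclidean unit sphere *)

Section SphereHomotopy.
Variables (R : realType) (n : nat).
Local Notation V := 'rV[R]_n.

Definition sqnorm (v : V) : R := \sum_(i < n) v ord0 i ^+ 2.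

Definition unit_sphere : set V := [set v | sqnorm v = 1].

Lemma sqnorm_continuous : continuous sqnorm.
Proof.
apply: continuous_big => [|i _ v]; first exact: add_continuous.
exact: (cvgM (@coord_continuous R 1 n ord0 i v) (@coord_continuous R 1 n ord0 i v)).
Qed.

Lemma sqnorm_ge0 v : 0 <= sqnorm v.
Proof. by apply: sumr_ge0 => i _; exact: sqr_ge0. Qed.

Lemma sqnorm0 : sqnorm 0 = 0.
Proof. by rewrite /sqnorm big1// => i _; rewrite mxE expr0n. Qed.

Lemma sqnorm_eq0 v : sqnorm v = 0 -> v = 0.
Proof.
move=> v0; apply/rowP => i; rewrite mxE.
have /psumr_eq0P -/(_ v0 i isT)/eqP : forall j, true -> 0 <= v ord0 j ^+ 2.
  by move=> j _; exact: sqr_ge0.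
by rewrite sqrf_eq0 => /eqP.
Qed.

Lemma sqnormZ a v : sqnorm (a *: v) = a ^+ 2 * sqnorm v.
Proof. by rewrite mulr_sumr; apply: eq_bigr => i _; rewrite mxE exprMn. Qed.

(** In each coordinate, [((1-t)a + tb)^2 = (1-t)a^2 + tb^2 - t(1-t)(a-b)^2]. *)
Lemma sqnorm_segment t v w : unit_sphere v -> unit_sphere w ->
  sqnorm ((1 - t) *: v + t *: w) = 1 - t * (1 - t) * sqnorm (v - w).
Proof.
rewrite /unit_sphere /= => v1 w1.
transitivity ((1 - t) * sqnorm v + t * sqnorm w - t * (1 - t) * sqnorm (v - w)).
  rewrite /sqnorm !mulr_sumr -big_split -sumrB /=.
  by apply: eq_bigr => i _; rewrite !mxE; ring.
by rewrite v1 w1; ring.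
Qed.

Lemma unit_sphere_compact : compact unit_sphere.
Proof.
apply: bounded_closed_compact; last first.
  have -> : unit_sphere = sqnorm @^-1` [set 1] by [].
  apply: preimage_closed; last exact: closed_eq.
  by move=> x _; exact: sqnorm_continuous.
exists 1; split=> // M M1 v /= v1.
(* The norm here is the largest absolute value of an entry; the square of each entry is one term of
   a sum equal to 1. *)
rewrite [leLHS]/Num.Def.normr /= mx_normrE; apply/bigmax_leP; split; first lra.
move=> [i j] _ /=; apply: le_trans (ltW M1); rewrite (ord1 i).
rewrite -(@expr_le1 _ 2)// real_normK ?num_real// -v1 /sqnorm (bigD1 j)//=.
by rewrite lerDl; apply: sumr_ge0 => k _; exact: sqr_ge0.
Qed.

(** Radial projection to the sphere, which turns a chord avoiding the origin into a great-circle
    arc. *)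
Definition normalize (v : V) : V := (Num.sqrt (sqnorm v))^-1 *: v.

Lemma normalize_unit v : 0 < sqnorm v -> unit_sphere (normalize v).
Proof.
move=> v_gt0; rewrite /unit_sphere /= /normalize sqnormZ exprVn sqr_sqrtr ?ltW//.
by rewrite mulVf ?gt_eqF.
Qed.

Lemma normalize_id v : unit_sphere v -> normalize v = v.
Proof. by rewrite /normalize => ->; rewrite sqrtr1 invr1 scale1r. Qed.

Lemma within_continuous_normalize (T : topologicalType) (A : set T) (f : T -> V) :
  (forall x, A x -> 0 < sqnorm (f x)) -> {within A, continuous f} ->
  {within A, continuous (fun x => normalize (f x))}.
Proof.
move=> f_gt0 cf; apply: within_continuous_scale => //.
apply: within_continuous_inv => [x Ax|].
  by rewrite gt_eqF// sqrtr_gt0 f_gt0.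
exact: (within_continuous_post (@sqrt_continuous R)
  (within_continuous_post sqnorm_continuous cf)).
Qed.

(** As [t(1-t) <= 1/4], the segment can reach the origin only between points at squared distance 4,
    that is, antipodal ones. The first two cases cover its ends, where antipodal points do no
    harm. *)
Lemma sqnorm_segment_gt0 t v w : unit_sphere v -> unit_sphere w ->
  [\/ t = 0, t = 1 | sqnorm (v - w) < 4] ->
  0 < sqnorm ((1 - t) *: v + t *: w).
Proof.
move=> v1 w1; rewrite sqnorm_segment//; case=> [->|->|]; try lra.
have := sqnorm_ge0 (v - w); have : t * (1 - t) <= 4^-1.
  by have := sqr_ge0 (t - 2^-1); nra.
by nra.
Qed.

(** * Making a homotopy constant on the diagonal *)

Local Notation I := (`[0, 1]%classic : set R).
Local Notation X := (unit_sphere `*` unit_sphere).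

Lemma homotopic_rel_diagonal (f g : V * V -> V * V) (H : R * (V * V) -> V * V) :
  {within X, continuous f} -> (forall p, X p -> X (f p)) ->
  (forall x, unit_sphere x -> f (x, x) = (x, x)) ->
  (forall x, unit_sphere x -> g (x, x) = (x, x)) ->
  {within I `*` X, continuous H} ->
  (forall t p, I t -> X p -> X (H (t, p))) ->
  (forall p, X p -> H (0, p) = f p) -> (forall p, X p -> H (1, p) = g p) ->
  exists K : R * (V * V) -> V * V,
    [/\ {within I `*` X, continuous K},
        (forall t p, I t -> X p -> X (K (t, p))),
        (forall p, X p -> K (0, p) = f p),
        (forall p, X p -> K (1, p) = g p) &
        (forall t x, I t -> unit_sphere x -> K (t, (x, x)) = (x, x))].
Proof.
move=> cf fX fD gD cH HX H0 H1.
pose k s (q : V * V) := ((H (s, (q.1, q.1))).1, (H (s, (q.2, q.2))).2).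
have kX s q : I s -> X q -> X (k s q).
  by move=> Is [q1 q2]; split; [case: (HX s (q.1, q.1))|case: (HX s (q.2, q.2))].
have k0 q : X q -> k 0 q = q.
  by case: q => q1 q2 [/= Sq1 Sq2]; rewrite /k /= !H0 ?fD.
have k1 q : X q -> k 1 q = q.
  by case: q => q1 q2 [/= Sq1 Sq2]; rewrite /k /= !H1 ?gD.
have kD s x : k s (x, x) = H (s, (x, x)) by rewrite /k /= -surjective_pairing.
have I0 : I 0 by rewrite /= in_itv /= lexx ler01.
have I1 : I 1 by rewrite /= in_itv /= lexx ler01.
(* Time and point are arbitrary functions here, so that [H] and [k] can be run along any clock and,
   for [k], at the diagonal points built from either coordinate. *)
have cHc (T : topologicalType) (A : set T) (s : T -> R) (q : T -> V * V) :
    (forall z, A z -> I (s z)) -> (forall z, A z -> X (q z)) ->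
    {within A, continuous s} -> {within A, continuous q} ->
    {within A, continuous (fun z => H (s z, q z))}.
  move=> sI qX cs cq.
  apply: (within_continuous_comp_within (B := I `*` X)
    (f := fun z => (s z, q z))) => //; first exact: within_continuous_pair.
  by move=> z Az; split; [exact: sI|exact: qX].
have ck (T : topologicalType) (A : set T) (s : T -> R) (q : T -> V * V) :
    (forall z, A z -> I (s z)) -> (forall z, A z -> X (q z)) ->
    {within A, continuous s} -> {within A, continuous q} ->
    {within A, continuous (fun z => k (s z) (q z))}.
  move=> sI qX cs cq; apply: within_continuous_pair.
    have cq1 := within_continuous_fst cq.
    apply: within_continuous_fst; apply: cHc => // [z /qX[]//|].
    exact: within_continuous_pair.
  have cq2 := within_continuous_snd cq.
  apply: within_continuous_snd; apply: cHc => // [z /qX[]//|].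
  exact: within_continuous_pair.
have cid := @within_continuous_id _ (I `*` X).
have cfst := within_continuous_fst cid.
have csnd := within_continuous_snd cid.
have cf2 : {within I `*` X, continuous (fun z => f z.2)}.
  by apply: within_continuous_comp_within csnd _ cf => z [].
pose sqdist (p q : V * V) := sqnorm (p.1 - q.1) + sqnorm (p.2 - q.2).
have csqdist (T : topologicalType) (A : set T) (p q : T -> V * V) :
    {within A, continuous p} -> {within A, continuous q} ->
    {within A, continuous (fun z => sqdist (p z) (q z))}.
  move=> cp cq; apply: within_continuous_add.
    apply: (within_continuous_post sqnorm_continuous).
    by apply: within_continuous_sub; exact: within_continuous_fst.
  apply: (within_continuous_post sqnorm_continuous).
  by apply: within_continuous_sub; exact: within_continuous_snd.
pose gap (p : V * V) := sqnorm (p.1 - p.2).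
have cgap : {within I `*` X, continuous (fun z => gap z.2)}.
  apply: (within_continuous_post sqnorm_continuous).
  apply: within_continuous_sub; first exact: within_continuous_fst csnd.
  exact: within_continuous_snd csnd.
(* The sum is positive: off the diagonal [gap] is, and on the diagonal [k_s(f p) = H_s(p)], so the
   second term is 1. Hence [gap p < m] forces [sqdist (k_s(f p)) (H_s(p)) < 1] for all times [s] at
   once. *)
have [m m_gt0 mP] : exists2 m, 0 < m & forall z, (I `*` X) z ->
    m <= gap z.2 + Num.max 0 (1 - sqdist (k z.1 (f z.2)) (H z)).
  apply: compact_pos_lower_bound.
  - apply: compact_setX; first exact: segment_compact.
    by apply: compact_setX; exact: unit_sphere_compact.
  - apply: within_continuous_add => //.
    apply: within_continuous_max; first exact: within_continuous_cst.
    apply: within_continuous_sub; first exact: within_continuous_cst.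
    by apply: csqdist => //; apply: ck => // z [] // _ /fX.
  - move=> [s [x y]] [/= Is Xxy].
    have [<-|xy] := eqVneq x y.
      rewrite fD; last by case: Xxy.
      by rewrite kD /sqdist /gap /= !subrr sqnorm0 addr0 subr0 add0r lt_max ltr01 orbT.
    apply: ltr_pwDl; last by rewrite le_max lexx.
    rewrite lt_neqAle sqnorm_ge0 andbT eq_sym; apply/eqP => /sqnorm_eq0/eqP.
    by rewrite subr_eq0 (negbTE xy).
(* Scaled so that [u p < 1] holds exactly when [gap p < m]. *)
pose u (p : V * V) : R := Num.min 1 (m^-1 * gap p).
have u_itv p : 0 <= u p <= 1.
  rewrite /u le_min ler01 ge_min lexx /= andbT.
  by rewrite mulr_ge0 ?invr_ge0 ?sqnorm_ge0 ?ltW.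
have uD x : u (x, x) = 0.
  by rewrite /u /gap /= subrr sqnorm0 mulr0 min_r.
have u_close s p : I s -> X p -> u p < 1 -> sqdist (k s (f p)) (H (s, p)) < 1.
  move=> Is Xp; rewrite /u gt_min ltxx /= mulrC ltr_pdivrMr// mul1r => gap_lt.
  by have := mP (s, p) (conj Is Xp) => /=; case: (leP 0 (1 - _)); lra.
have cu : {within I `*` X, continuous (fun z => u z.2)}.
  apply: within_continuous_min; first exact: within_continuous_cst.
  by apply: within_continuous_mul => //; exact: within_continuous_cst.
(* The jump takes place for [t] in [[1/3, 2/3]], where both clocks [alpha] and
   [beta] stand still at [1 - u]. *)
pose alpha (z : R * (V * V)) : R := 1 - u z.2 * Num.min 1 (3 * z.1).
pose beta (z : R * (V * V)) : R := 1 - u z.2 * Num.min 1 (3 * (1 - z.1)).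
pose tau (t : R) : R := Num.max 0 (Num.min 1 (3 * t - 1)).
have alphaI z : (I `*` X) z -> I (alpha z).
  case: z => t p [/= /itvP tI _]; rewrite /alpha /= in_itv /=.
  have : 0 <= Num.min 1 (3 * t) <= 1.
    by rewrite le_min ge_min lexx ler01 /= mulr_ge0 ?tI.
  by have := u_itv p; nra.
have betaI z : (I `*` X) z -> I (beta z).
  case: z => t p [/= /itvP tI _]; rewrite /beta /= in_itv /=.
  have : 0 <= Num.min 1 (3 * (1 - t)) <= 1.
    by rewrite le_min ge_min lexx ler01 /= mulr_ge0 ?subr_ge0 ?tI.
  by have := u_itv p; nra.
(* The two legs of the journey: [a] starts at [k_1(f p) = f p], and [b] ends at [H_1(p) = g p]. The
   parameter [tau] carries the first over to the second. *)
pose a z := k (alpha z) (f z.2).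
pose b z := H (beta z, z.2).
have aX z : (I `*` X) z -> X (a z).
  by move=> zIX; apply: kX; [exact: alphaI|case: zIX => _ /fX].
have bX z : (I `*` X) z -> X (b z).
  by move=> zIX; apply: HX; [exact: betaI|case: zIX].
have cmul3 (s : R * (V * V) -> R) : {within I `*` X, continuous s} ->
    {within I `*` X, continuous (fun z => Num.min 1 (3 * s z))}.
  move=> cs; apply: within_continuous_min; first exact: within_continuous_cst.
  by apply: within_continuous_mul => //; exact: within_continuous_cst.
have ca : {within I `*` X, continuous a}.
  apply: ck => //; first by move=> z [_ /fX].
  apply: within_continuous_sub; first exact: within_continuous_cst.
  by apply: within_continuous_mul => //; exact: cmul3.
have cb : {within I `*` X, continuous b}.
  apply: cHc => //; first by move=> z [].
  apply: within_continuous_sub; first exact: within_continuous_cst.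
  apply: within_continuous_mul => //; apply: cmul3.
  by apply: within_continuous_sub => //; exact: within_continuous_cst.
have ctau : {within I `*` X, continuous (fun z => tau z.1)}.
  apply: within_continuous_max; first exact: within_continuous_cst.
  apply: within_continuous_min; first exact: within_continuous_cst.
  apply: within_continuous_sub; last exact: within_continuous_cst.
  by apply: within_continuous_mul => //; exact: within_continuous_cst.
(* Outside the middle third [tau] is 0 or 1. Inside it both clocks read [1 - u]: if [u < 1], the
   choice of [m] gives squared distance below 1; if [u = 1], both legs are at time 0, where
   [k_0(f p) = f p = H_0(p)]. *)
have close z : (I `*` X) z ->
    [\/ tau z.1 = 0, tau z.1 = 1 | sqdist (a z) (b z) < 4].
  case: z => t p [/= It Xp].
  have [t_small|t_big] := leP (3 * t - 1) 0.
    by constructor 1; rewrite /tau max_l// ge_min t_small orbT.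
  have [t_large|t_mid] := leP 1 (3 * t - 1).
    by constructor 2; rewrite /tau min_l// max_r.
  constructor 3; rewrite /a /b /alpha /beta /= !min_l ?mulr1; [|lra|lra].
  have [u1|u1] := ltP (u p) 1.
    have Iu : I (1 - u p) by rewrite /= in_itv /=; have := u_itv p; lra.
    by have := u_close _ _ Iu Xp u1; lra.
  have -> : 1 - u p = 0 by have := u_itv p; lra.
  by rewrite k0 ?H0 /sqdist ?subrr ?sqnorm0 ?addr0//; exact: fX.
(* The jump is made in each factor separately. Since [sqdist] is the sum of the squared distances in
   the two factors, its bound by 4 serves both. *)
pose v1 z := (1 - tau z.1) *: (a z).1 + tau z.1 *: (b z).1.
pose v2 z := (1 - tau z.1) *: (a z).2 + tau z.1 *: (b z).2.
have v1_gt0 z : (I `*` X) z -> 0 < sqnorm (v1 z).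
  move=> zIX; apply: sqnorm_segment_gt0; [by case: (aX z)|by case: (bX z)|].
  case: (close z zIX) => [|| h]; [by constructor 1|by constructor 2|constructor 3].
  by apply: le_lt_trans h; rewrite lerDl sqnorm_ge0.
have v2_gt0 z : (I `*` X) z -> 0 < sqnorm (v2 z).
  move=> zIX; apply: sqnorm_segment_gt0; [by case: (aX z)|by case: (bX z)|].
  case: (close z zIX) => [|| h]; [by constructor 1|by constructor 2|constructor 3].
  by apply: le_lt_trans h; rewrite lerDr sqnorm_ge0.
have tau0 : tau 0 = 0 by rewrite /tau min_r ?max_l; lra.
have tau1 : tau 1 = 1 by rewrite /tau min_l ?max_r; lra.
exists (fun z => (normalize (v1 z), normalize (v2 z))); split.
- apply: within_continuous_pair; apply: within_continuous_normalize => //.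
    apply: within_continuous_add; apply: within_continuous_scale => //.
    + by apply: within_continuous_sub => //; exact: within_continuous_cst.
    + exact: within_continuous_fst.
    + exact: within_continuous_fst.
  apply: within_continuous_add; apply: within_continuous_scale => //.
  + by apply: within_continuous_sub => //; exact: within_continuous_cst.
  + exact: within_continuous_snd.
  + exact: within_continuous_snd.
- by move=> t p It Xp; split; apply: normalize_unit; [exact: v1_gt0|exact: v2_gt0].
- move=> p Xp; have [Sfp1 Sfp2] := fX _ Xp.
  have a0 : a (0, p) = f p.
    have -> : a (0, p) = k (alpha (0, p)) (f p) by [].
    by rewrite /alpha /= mulr0 min_r// mulr0 subr0 k1//; exact: fX.
  rewrite /v1 /v2 a0 [(0, p).1]/= tau0 subr0 !scale1r !scale0r !addr0.
  by rewrite !normalize_id// -surjective_pairing.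
- move=> p Xp; have [SHp1 SHp2] := HX _ _ I1 Xp.
  have b1 : b (1, p) = H (1, p).
    by rewrite /b /beta /= subrr mulr0 min_r// mulr0 subr0.
  rewrite /v1 /v2 b1 [(1, p).1]/= tau1 subrr !scale1r !scale0r !add0r.
  by rewrite !normalize_id// -surjective_pairing H1.
- move=> t x It Sx.
  (* On the diagonal [u = 0], so both clocks stay at 1, where [k_1] is the identity and [H_1 = g]
     fixes the diagonal. The two legs thus coincide, and the value of [tau] is immaterial. *)
  have aD : a (t, (x, x)) = (x, x).
    have -> : a (t, (x, x)) = k (alpha (t, (x, x))) (f (x, x)) by [].
    by rewrite /alpha /= uD mul0r subr0 fD// k1.
  have bD : b (t, (x, x)) = (x, x).
    by rewrite /b /beta /= uD mul0r subr0 H1// gD.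
  by rewrite /v1 /v2 aD bD -!scalerDl subrK scale1r normalize_id.
Qed.

End SphereHomotopy.

Unset Implicit Arguments.

Theorem theorem1p1 (n : nat) (hn : (1 <= n)%N) (f g : E n * E n -> E n * E n) :
  under_diag n f -> under_diag n g ->
  homotopic_rel n [set basept n] f g ->
  homotopic_rel n (diag_set n) f g.
Proof.
move=> [[cf fX] fD] [_ gD] [H [cH HX H0 H1 _]].
have diagP (x : E n) : sphere n x -> diag_set n (x, x) by [].
(* The ends of the time interval are numerals of the standard library reals; they become the ring
   elements 0 and 1. *)
move: cH HX H0 H1; rewrite /homotopic_rel R0E R1E => cH HX H0 H1.
(* In dimension [n.+1], [unit_sphere] unfolds to [sphere n] and its square to [SnxSn n], so the
   hypotheses apply as they are. *)
have [K [cK KX K0 K1 KD]] := @homotopic_rel_diagonal _ _ f g H cf fX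
  (fun x Sx => fD _ (diagP x Sx)) (fun x Sx => gD _ (diagP x Sx)) cH HX H0 H1.
exists K; split => // t [x y] It [/= Sx ->].
by rewrite KD// fD.
Qed.
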